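(* Let $N\ge2$, let $q\in\mathbb{C}^\times$ not be a root of unity, with a fixed $N$-th root $q^{1/N}$, and let $c\in\mathbb{C}^\times$. The algebra $\mathrm{Cl}_q(c)=T(H)/\langle x-\beta_c(x):x\in R_H\rangle$ (see context) is isomorphic to $$T(H)/\langle x\otimes y+\sigma(x\otimes y)-(x,y)_c : x,y\in H\rangle,$$ where the bilinear form $(\cdot,\cdot)_c:H\otimes H\to\mathbb{C}$ is defined by $$(\cdot,\cdot)_c=\begin{cases} c\,\langle\cdot,\cdot\rangle & \text{on } V^*\otimes V,\\ c\,\langle\cdot,\cdot\rangle\circ q^{-1+\frac1N}\widehat{R}_{V^*,V}^{-1} & \text{on } V\otimes V^*,\\ 0 & \text{on } V\otimes V \text{ and } V^*\otimes V^*.\end{cases}$$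
   Context: $\theta(n)=1$ for $n>0$ and $\theta(n)=0$ for $n\le 0$. $V$ has basis $v_1,\dots,v_N$, $V^*$ has basis $w_1,\dots,w_N$, $H=V\oplus V^*$, and $\langle\cdot,\cdot\rangle:V^*\otimes V\to\mathbb{C}$ is the pairing with $\langle w_i,v_j\rangle=\delta_{ij}$. The braidings (for the fundamental module $V$ of $U_q(\mathfrak{sl}_N)$ and its dual) are $$\widehat{R}_{V,V}(v_i\otimes v_j)=q^{\delta_{ij}-\frac1N}v_j\otimes v_i+\theta(j-i)q^{-\frac1N}(q-q^{-1})v_i\otimes v_j,$$ $$\widehat{R}_{V^*,V^*}(w_i\otimes w_j)=q^{\delta_{ij}-\frac1N}w_j\otimes w_i+\theta(i-j)q^{-\frac1N}(q-q^{-1})w_i\otimes w_j,$$ $$\widehat{R}_{V^*,V}(w_i\otimes v_j)=q^{\frac1N-\delta_{ij}}v_j\otimes w_i-\delta_{ij}q^{\frac1N}(q-q^{-1})\sum_{k=1}^{i-1}v_k\otimes w_k\in V\otimes V^*.$$ The linear map $\sigma:H\otimes H\to H\otimes H$ equals $q^{1+\frac1N}\widehat{R}_{V,V}$ on $V\otimes V$, $q^{-1+\frac1N}\widehat{R}_{V^*,V}^{-1}$ on $V\otimes V^*$, $q^{1-\frac1N}\widehat{R}_{V^*,V}$ on $V^*\otimes V$, and $q^{1+\frac1N}\widehat{R}_{V^*,V^*}$ on $V^*\otimes V^*$. The space $R_H=\mathrm{im}(\mathrm{id}+\sigma)\subset H\otimes H$ has basis $\mathcal{V}_{ij}=(\mathrm{id}+\sigma)(v_i\otimes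 v_j)$ for $i\ge j$, $\mathcal{W}_{ij}=(\mathrm{id}+\sigma)(w_i\otimes w_j)$ for $i\le j$, $\mathcal{M}_{ij}=(\mathrm{id}+\sigma)(w_i\otimes v_j)$ for all $i,j$. The linear map $\beta_c:R_H\to\mathbb{C}$ is defined by $\beta_c(\mathcal{V}_{ij})=\beta_c(\mathcal{W}_{ij})=0$, $\beta_c(\mathcal{M}_{ij})=\delta_{ij}c$. Angle brackets around a set denote the two-sided ideal of $T(H)$ it generates. *)

(* Defs.v *)
From HB Require Import structures.
From mathcomp Require Import all_boot all_order all_algebra.
From mathcomp Require Import generic_quotient ring_quotient.
From mathcomp Require Import boolp classical_sets reals.
From mathcomp Require Import complex.
From mathcomp Require Import monalg.

Set Implicit Arguments.
Unset Strict Implicit.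
Unset Printing Implicit Defensive.

Import Order.TTheory GRing.Theory Num.Theory.
Local Open Scope ring_scope.
Local Open Scope quotient_scope.
Local Open Scope classical_set_scope.

(******************************************************************************)
(* The quotient of an algebra by the two-sided ideal generated by a set. It   *)
(* may be the zero ring, whereas lalgType and algType require 1 != 0; it is   *)
(* therefore only equipped with its pzRingType and lmodType structures, and   *)
(* the compatibility of scaling and product is stated by quot_scalerAl.       *)
(******************************************************************************)

Section QuotientAlgebra.
Variables (K : nzRingType) (A : lalgType K).
Implicit Types (S I : set A) (x y a : A).

Definition two_sided_ideal I : Prop :=
  [/\ I 0,
      forall x y, I x -> I y -> I (x + y),
      forall a x, I x -> I (a * x)
    & forall a x, I x -> I (x * a)].

Definition ideal_gen S : set A := smallest two_sided_ideal S.

Lemma ideal_genP S : two_sided_ideal (ideal_gen S).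
Proof.
split.
- by move=> I [[]].
- move=> x y Ix Iy I SI; case: (SI) => -[_ ID _ _] _.
  by apply: ID; [exact: Ix | exact: Iy].
- move=> a x Ix I SI; case: (SI) => -[_ _ IM _] _.
  by apply: IM; exact: Ix.
- move=> a x Ix I SI; case: (SI) => -[_ _ _ IM] _.
  by apply: IM; exact: Ix.
Qed.

Definition in_ideal_gen S : {pred A} := fun x => `[< ideal_gen S x >].

Lemma in_ideal_genP S x : reflect (ideal_gen S x) (x \in in_ideal_gen S).
Proof. exact: asboolP. Qed.

Lemma in_ideal_gen_zmod_closed S : zmod_closed (in_ideal_gen S).
Proof.
have [I0 ID IMl _] := ideal_genP S.
split=> [|x y /in_ideal_genP Ix /in_ideal_genP Iy]; apply/in_ideal_genP=> //.
by apply: (ID _ _ Ix); rewrite -mulN1r; exact: (IMl _ _ Iy).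
Qed.

HB.instance Definition _ S :=
  GRing.isZmodClosed.Build A (in_ideal_gen S) (in_ideal_gen_zmod_closed S).

Definition quot_alg S : Type := {ideal_quot (in_ideal_gen S)}.

HB.instance Definition _ S := Choice.on (quot_alg S).
HB.instance Definition _ S := EqQuotient.on (quot_alg S).
HB.instance Definition _ S := GRing.Zmodule.on (quot_alg S).

Section Structure.
Variable S : set A.
Local Notation Q := (quot_alg S).

Lemma quot_eqP x y : reflect (\pi_Q x = \pi_Q y) (x - y \in in_ideal_gen S).
Proof. by rewrite (Quotient.idealrBE (in_ideal_gen S)); exact: eqP. Qed.

Lemma quot_piD x y : \pi_Q (x + y) = \pi_Q x + \pi_Q y.
Proof. exact: (Quotient.pi_add (in_ideal_gen S)). Qed.

Definition quot_one : Q := \pi_Q 1.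
Definition quot_mul : Q -> Q -> Q := lift_op2 Q *%R.
Definition quot_scale (k : K) : Q -> Q := lift_op1 Q ( *:%R k).

Lemma quot_piM x y : \pi_Q (x * y) = quot_mul (\pi_Q x) (\pi_Q y).
Proof.
have [I0 ID IMl IMr] := ideal_genP S; unlock quot_mul.
apply/quot_eqP/in_ideal_genP.
have -> : x * y - repr (\pi_Q x) * repr (\pi_Q y) =
    (x - repr (\pi_Q x)) * y + repr (\pi_Q x) * (y - repr (\pi_Q y)).
  by rewrite mulrBl mulrBr addrA subrK.
by apply: (ID _ _ (IMr _ _ _) (IMl _ _ _));
  apply/in_ideal_genP/quot_eqP; rewrite reprK.
Qed.

Lemma quot_piZ k x : \pi_Q (k *: x) = quot_scale k (\pi_Q x).
Proof.
have [I0 ID IMl IMr] := ideal_genP S; unlock quot_scale.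
apply/quot_eqP/in_ideal_genP; rewrite -scalerBr -[_ - _]mul1r scalerAl.
by apply: (IMl _ _ _); apply/in_ideal_genP/quot_eqP; rewrite reprK.
Qed.

Lemma quot_mulA : associative quot_mul.
Proof.
by elim/quotW=> x; elim/quotW=> y; elim/quotW=> z; rewrite -!quot_piM mulrA.
Qed.

Lemma quot_mul1l : left_id quot_one quot_mul.
Proof. by elim/quotW=> x; rewrite -quot_piM mul1r. Qed.

Lemma quot_mul1r : right_id quot_one quot_mul.
Proof. by elim/quotW=> x; rewrite -quot_piM mulr1. Qed.

Lemma quot_mulDl : left_distributive quot_mul +%R.
Proof.
elim/quotW=> x; elim/quotW=> y; elim/quotW=> z.
by rewrite -quot_piD -!quot_piM -quot_piD mulrDl.
Qed.

Lemma quot_mulDr : right_distributive quot_mul +%R.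
Proof.
elim/quotW=> x; elim/quotW=> y; elim/quotW=> z.
by rewrite -quot_piD -!quot_piM -quot_piD mulrDr.
Qed.

HB.instance Definition _ := GRing.Zmodule_isPzRing.Build Q
  quot_mulA quot_mul1l quot_mul1r quot_mulDl quot_mulDr.

Lemma quot_scaleA k l u : quot_scale k (quot_scale l u) = quot_scale (k * l) u.
Proof. by elim/quotW: u => x; rewrite -!quot_piZ scalerA. Qed.

Lemma quot_scale1 : left_id 1 quot_scale.
Proof. by elim/quotW=> x; rewrite -quot_piZ scale1r. Qed.

Lemma quot_scaleDr : right_distributive quot_scale +%R.
Proof.
move=> k; elim/quotW=> x; elim/quotW=> y.
by rewrite -quot_piD -!quot_piZ -quot_piD scalerDr.
Qed.

Lemma quot_scaleDl u : {morph quot_scale^~ u : k l / k + l}.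
Proof.
by move=> k l; elim/quotW: u => x /=; rewrite -!quot_piZ -quot_piD scalerDl.
Qed.

HB.instance Definition _ := GRing.Zmodule_isLmodule.Build K Q
  quot_scaleA quot_scale1 quot_scaleDr quot_scaleDl.

Lemma quot_scalerAl (k : K) (u v : Q) : k *: (u * v) = (k *: u) * v.
Proof.
elim/quotW: u => x; elim/quotW: v => y; rewrite /GRing.scale /GRing.mul /=.
by rewrite -quot_piM -!quot_piZ -quot_piM scalerAl.
Qed.

End Structure.

End QuotientAlgebra.

(******************************************************************************)
(* bsp I is the K-vector space with basis (bvec i)_(i : I). The tensor        *)
(* product of bsp I and bsp J is bsp (I * J), with basis                      *)
(* bvec (i, j) = tens (bvec i) (bvec j).                                      *)
(******************************************************************************)

Section BasedSpaces.
Variable K : fieldType.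

Definition bsp (I : finType) := {ffun I -> K^o}.
HB.instance Definition _ I := Vector.on (bsp I).

Definition bvec (I : finType) (i : I) : bsp I := [ffun j => (i == j)%:R].

Definition linext (I : finType) (E : lmodType K) (g : I -> E) (x : bsp I) : E :=
  \sum_i (x i : K) *: g i.

Lemma linext_is_linear (I : finType) (E : lmodType K) (g : I -> E) :
  linear (@linext I E g).
Proof.
move=> k x y; rewrite /linext scaler_sumr -big_split; apply: eq_bigr => i _.
by rewrite !ffunE scalerDl scalerA.
Qed.

HB.instance Definition _ (I : finType) (E : lmodType K) (g : I -> E) :=
  GRing.isLinear.Build K (bsp I) E _ (@linext I E g) (@linext_is_linear I E g).

Lemma linext_bvec (I : finType) (E : lmodType K) (g : I -> E) i :
  linext g (bvec i) = g i.
Proof.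
rewrite /linext (bigD1 i) //= ffunE eqxx scale1r big1 ?addr0 // => j ji.
by rewrite ffunE eq_sym (negPf ji) scale0r.
Qed.

Definition tens (I J : finType) (x : bsp I) (y : bsp J) : bsp (I * J)%type :=
  [ffun p => (x p.1 : K) * y p.2].

Lemma tens_bvec (I J : finType) (i : I) (j : J) :
  tens (bvec i) (bvec j) = bvec (i, j).
Proof. by apply/ffunP=> -[k l]; rewrite !ffunE /= -natrM mulnb xpair_eqE. Qed.

End BasedSpaces.


(******************************************************************************)
(* s stands for the chosen root q^{1/N}, so that for instance q^{-1/N} is     *)
(* s^-1 and q^{1+1/N} is q * s. Indices run over 'I_N = {0, ..., N-1} instead *)
(* of {1, ..., N}. Both V and V^* are bsp 'I_N, with the bases v_i and w_i;   *)
(* in H = V (+) V^*, v_i has index inl i and w_i has index inr i.             *)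
(******************************************************************************)

Section CliffordAlgebra.
Variables (K : fieldType) (N : nat) (q s c : K).

Local Notation VV := (bsp K ('I_N * 'I_N)%type).

Definition hidx : finType := ('I_N + 'I_N)%type.
Definition H := bsp K hidx.
Definition HH := bsp K (hidx * hidx)%type.

Definition theta (n : int) : K := if 0 < n then 1 else 0.

(* v_i (x) v_j, w_i (x) w_j, v_i (x) w_j or w_i (x) v_j, according to which
   of the four spaces VV stands for *)
Local Notation e i j := (tens (bvec K i) (bvec K j)).

(* V (x) V -> V (x) V *)
Definition R_VV : 'Hom(VV, VV) :=
  linfun (linext (fun p : 'I_N * 'I_N => let: (i, j) := p in
    (q ^+ (i == j) * s^-1) *: e j i
    + (theta (j%:Z - i%:Z) * s^-1 * (q - q^-1)) *: e i j)).

(* V^* (x) V^* -> V^* (x) V^* *)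
Definition R_WW : 'Hom(VV, VV) :=
  linfun (linext (fun p : 'I_N * 'I_N => let: (i, j) := p in
    (q ^+ (i == j) * s^-1) *: e j i
    + (theta (i%:Z - j%:Z) * s^-1 * (q - q^-1)) *: e i j)).

(* V^* (x) V -> V (x) V^* *)
Definition R_WV : 'Hom(VV, VV) :=
  linfun (linext (fun p : 'I_N * 'I_N => let: (i, j) := p in
    (s * q ^- (i == j)) *: e j i
    - ((i == j)%:R * s * (q - q^-1)) *: \sum_(k < N | (k < i)%N) e k k)).

(* The inclusions of the four blocks of H (x) H *)
Definition incl (f g : 'I_N -> hidx) : VV -> HH :=
  linext (fun p => bvec K (f p.1, g p.2)).

Definition inV : 'I_N -> hidx := inl.
Definition inW : 'I_N -> hidx := inr.

(* R_WV is bijective for nonzero q and s, so R_WV^-1 (a partial inverse for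
   general linear maps) is its inverse V (x) V^* -> V^* (x) V *)
Definition sigma : 'End(HH) :=
  linfun (linext (fun p : hidx * hidx => match p with
    | (inl i, inl j) => (q * s) *: incl inV inV (R_VV (e i j))
    | (inl i, inr j) => (q^-1 * s) *: incl inW inV ((R_WV^-1)%VF (e i j))
    | (inr i, inl j) => (q * s^-1) *: incl inV inW (R_WV (e i j))
    | (inr i, inr j) => (q * s) *: incl inW inW (R_WW (e i j))
    end)).

Definition id_sigma : 'End(HH) := (\1 + sigma)%VF.

Definition R_H : {vspace HH} := limg id_sigma.

(* The indices of the vectors V_ij (i >= j), W_ij (i <= j) and M_ij *)
Definition R_H_index : seq (hidx * hidx) :=
  [seq p : hidx * hidx <- enum {: hidx * hidx} | match p with
    | (inl i, inl j) => (j <= i)%N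
    | (inr i, inr j) => (i <= j)%N
    | (inr _, inl _) => true
    | (inl _, inr _) => false
    end].

Definition R_H_basis : seq HH := [seq id_sigma (bvec K p) | p <- R_H_index].

Definition beta_val (p : hidx * hidx) : K :=
  match p with
  | (inr i, inl j) => (i == j)%:R * c
  | _ => 0
  end.

(* The linear form on R_H taking the values beta_val on R_H_basis, which is a
   basis of R_H when q is neither zero nor a root of unity *)
Definition beta (x : subvs_of R_H) : K :=
  \sum_(k < size R_H_basis)
    coord (in_tuple R_H_basis) k (vsval x)
      * [seq beta_val p | p <- R_H_index]`_k.

(* <.,.> on V^* (x) V *)
Definition pairing : VV -> K^o := linext (fun p => (p.1 == p.2)%:R).

(* The bilinear form (.,.)_c, as a linear form on H (x) H *)
Definition clifford_form : HH -> K^o :=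
  linext (fun p : hidx * hidx => match p return K^o with
    | (inr i, inl j) => c * pairing (e i j)
    | (inl i, inr j) => c * pairing ((q^-1 * s) *: (R_WV^-1)%VF (e i j))
    | _ => 0
    end).

(* T(H) is the free algebra on the basis of H *)
Definition TH := {malg K[{fmonom hidx}]}.
HB.instance Definition _ := GRing.Lalgebra.on TH.

Definition gen (a : hidx) : TH := << fmu a >>.

(* The inclusion of H (x) H in T(H) *)
Definition iota2 : HH -> TH := linext (fun p => gen p.1 * gen p.2).

Definition Cl_rel : set TH :=
  [set iota2 (vsval x) - (beta x)%:A | x in [set: subvs_of R_H]].

Definition clifford_rel : set TH :=
  [set iota2 (tens x y + sigma (tens x y)) - (clifford_form (tens x y))%:A
    | x in [set: H] & y in [set: H]].

End CliffordAlgebra.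

Arguments Cl_rel {K} N q s c _.
Arguments clifford_rel {K} N q s c _.

(* Main.v *)
(* The relations x - beta(x) and x (x) y + sigma(x (x) y) - (x, y)_c span the
   same subspace of T(H), because (., .)_c = beta o (id + sigma) on H (x) H.
   This identity is checked on basis vectors: for i < j, V_ij = q V_ji and
   W_ji = q W_ij, while sigma exchanges V (x) V^* and V^* (x) V involutively,
   so that (id + sigma) z = (id + sigma) (sigma z) for z in V (x) V^*. *)
From HB Require Import structures.
Require Import Defs.
From mathcomp Require Import all_boot all_order all_algebra.
From mathcomp Require Import generic_quotient boolp classical_sets.
From mathcomp Require Import reals complex ring.

Set Implicit Arguments.
Unset Strict Implicit.
Unset Printing Implicit Defensive.

Import GRing.Theory Num.Theory.
Local Open Scope ring_scope.

(** * Quotients of an algebra by equal two-sided ideals *)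

Section QuotientEquality.
Variables (K : nzRingType) (A : lalgType K).
Implicit Types S : set A.
Local Open Scope quotient_scope.

Lemma ideal_gen_sub S S' :
  (S `<=` ideal_gen S' -> ideal_gen S `<=` ideal_gen S')%classic.
Proof. by move=> sub x; apply; split=> //; exact: ideal_genP. Qed.

(** Scaling by [k] is left multiplication by [k *: 1], which the ideal absorbs. *)
Lemma ideal_genZ S (k : K) x : ideal_gen S x -> ideal_gen S (k *: x).
Proof.
have [_ _ IM _] := ideal_genP S.
by move=> Ix; rewrite -[x]mul1r scalerAl; exact: IM.
Qed.

(** Going through [repr] makes the map total; an inclusion of the ideals is what makes it
    independent of the representative. *)
Definition quot_map S S' (u : quot_alg S) : quot_alg S' :=
  \pi_(quot_alg S') (repr u).

Lemma quot_map_pi S S' x : (ideal_gen S `<=` ideal_gen S')%classic ->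
  quot_map S' (\pi_(quot_alg S) x) = \pi_(quot_alg S') x.
Proof.
move=> sub; apply/quot_eqP/in_ideal_genP; apply: (sub).
by apply/in_ideal_genP/quot_eqP; rewrite reprK.
Qed.

Lemma quot_iso S S' :
    (ideal_gen S `<=` ideal_gen S')%classic ->
    (ideal_gen S' `<=` ideal_gen S)%classic ->
  exists f : {linear quot_alg S -> quot_alg S'},
    monoid_morphism f /\ bijective f.
Proof.
move=> sub sub'; pose f := @quot_map S S'.
have fE x : f (\pi_(quot_alg S) x) = \pi_(quot_alg S') x.
  exact: quot_map_pi.
have f_linear : linear f.
  move=> k; elim/quotW=> x; elim/quotW=> y.
  rewrite !fE /GRing.scale /= -!quot_piZ -!quot_piD; exact: fE.
pose fL := GRing.isLinear.Build _ _ _ _ f f_linear.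
pose F : {linear quot_alg S -> quot_alg S'} := HB.pack f fL.
exists F; split.
  split; first exact: (fE 1).
  elim/quotW=> x; elim/quotW=> y; rewrite /= !fE /GRing.mul /= -!quot_piM.
  exact: fE.
have gE x : quot_map S (\pi_(quot_alg S') x) = \pi_(quot_alg S) x.
  exact: quot_map_pi.
exists (@quot_map S' S); elim/quotW=> x.
  by rewrite [X in quot_map _ X]fE gE.
by rewrite gE [LHS]fE.
Qed.

End QuotientEquality.

(** * Linear maps and free families in coordinates *)

Section BasedSpaceLemmas.
Variable K : fieldType.

Lemma bsp_sum (I : finType) (x : bsp K I) :
  x = \sum_i (x i : K) *: bvec K i.
Proof.
apply/ffunP=> j; rewrite sum_ffunE (bigD1 j) //= !ffunE eqxx.
rewrite big1 ?addr0 => [|i ij]; first by rewrite /GRing.scale /= mulr1.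
by rewrite !ffunE (negPf ij) scaler0.
Qed.

Lemma eq_on_bvec (I : finType) (E : lmodType K) (f g : {linear bsp K I -> E}) :
  (forall i, f (bvec K i) = g (bvec K i)) -> f =1 g.
Proof.
move=> fg x; rewrite (bsp_sum x) !linear_sum; apply: eq_bigr => i _.
by rewrite !linearZ fg.
Qed.

(** Restricted to the coordinates in [s], the family is a diagonal matrix with nonzero entries, so
    reading a vanishing combination at coordinate [p] kills the coefficient of [F p]. *)
Lemma free_diagonal (I : finType) (s : seq I) (F : I -> bsp K I) : uniq s ->
    {in s, forall p, F p p != 0} ->
    {in s &, forall p p', p != p' -> F p p' = 0} ->
  free [seq F p | p <- s].
Proof.
case: s => [|p0 s0]; first by rewrite nil_free.
set s := p0 :: s0 => s_uniq Fd F0.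
apply/(@freeP _ _ _ (in_tuple [seq F p | p <- s])) => k sum0 i.
have lt (j : 'I_(size [seq F p | p <- s])) : (j < size s)%N.
  by rewrite -(size_map F).
have nthE (j : 'I_(size [seq F p | p <- s])) :
    (in_tuple [seq F p | p <- s])`_j = F (nth p0 s j).
  exact: (nth_map p0 _ _ (lt j)).
have := congr1 (fun x : bsp K I => x (nth p0 s i)) sum0.
rewrite sum_ffunE (bigD1 i) //= big1 => [|j ji].
  rewrite !ffunE nthE addr0 => /eqP.
  by rewrite mulf_eq0 (negPf (Fd _ _)) ?mem_nth ?lt // orbF => /eqP.
rewrite !ffunE nthE F0 ?mem_nth ?lt ?scaler0 //.
by rewrite nth_uniq ?lt.
Qed.

End BasedSpaceLemmas.

(** * The braidings on basis vectors *)

Section Clifford.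
Variables (K : fieldType) (N : nat) (q s c : K).
Hypotheses (q_neq0 : q != 0) (s_neq0 : s != 0) (q2_neqN1 : 1 + q ^+ 2 != 0).

Local Notation VV := (bsp K ('I_N * 'I_N)%type).
Local Notation R_WV := (@R_WV K N q s).
Local Notation id_sigma := (@id_sigma K N q s).
Local Notation sigma := (@sigma K N q s).
Local Notation b p := (bvec K (p : @hidx N * @hidx N)).
Local Notation index := (R_H_index N).
Local Notation basis := (R_H_basis N q s).

HB.instance Definition _ (f g : 'I_N -> hidx N) :=
  GRing.Linear.on (@incl K N f g).

Lemma incl_bvec (f g : 'I_N -> hidx N) i j :
  incl f g (bvec K (i, j)) = b (f i, g j).
Proof. exact: linext_bvec. Qed.

(** Makes the partial inverse [R_WV^-1] a genuine right inverse. Off the diagonal [R_WV] swaps basis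
    vectors up to the factor s; on the diagonal it is triangular with leading coefficient s / q and
    lower terms k < i, whence the strong induction. *)
Lemma R_WV_surj : limg R_WV = fullv.
Proof.
have off i j : i != j -> bvec K (j, i) \in limg R_WV.
  move=> ij; have -> : bvec K (j, i) = R_WV (s^-1 *: bvec K (i, j)).
    rewrite linearZ /= lfunE /= linext_bvec /= (negPf ij) !mul0r scale0r subr0.
    by rewrite expr0 invr1 mulr1 scalerA mulVf // scale1r tens_bvec.
  exact: memv_img (memvf _).
have diag n (i : 'I_N) : (i <= n)%N -> bvec K (i, i) \in limg R_WV.
  elim/ltn_ind: n i => n IHn i le_in.
  have : R_WV (bvec K (i, i)) \in limg R_WV by exact: memv_img (memvf _).
  rewrite lfunE /= linext_bvec /= eqxx expr1 mul1r tens_bvec => mem_i.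
  suff : (s / q) *: bvec K (i, i) \in limg R_WV.
    by rewrite rpredZeq mulf_eq0 invr_eq0 (negPf s_neq0) (negPf q_neq0).
  move: mem_i; rewrite rpredBr //; apply/rpredZ/rpred_sum => k lt_ki.
  by rewrite tens_bvec; apply: (IHn k) => //; exact: leq_trans lt_ki le_in.
apply/eqP; rewrite eqEsubv subvf; apply/subvP => x _.
rewrite (bsp_sum x); apply: rpred_sum => -[i j] _; apply: rpredZ.
by have [<-|ij] := eqVneq i j; [exact: (diag i) | apply: off; rewrite eq_sym].
Qed.

Lemma R_WV_invK : cancel (R_WV^-1)%VF R_WV.
Proof. by move=> x; apply: limg_lfunVK; rewrite R_WV_surj memvf. Qed.

Lemma id_sigmaE z : id_sigma z = z + sigma z.
Proof. by rewrite add_lfunE id_lfunE. Qed.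

(** The prefactor q s of [sigma] cancels the s^-1 of [R_VV], so only powers of q remain. *)
Lemma sigma_VV i j : sigma (b (inl i, inl j)) =
  (q ^+ (i == j).+1) *: b (inl j, inl i)
  + (if (i < j)%N then q ^+ 2 - 1 else 0) *: b (inl i, inl j).
Proof.
rewrite lfunE /= linext_bvec /= !tens_bvec lfunE /= linext_bvec !tens_bvec.
rewrite linearD !linearZ /= !incl_bvec scalerDr !scalerA.
congr (_ *: _ + _ *: _).
  by rewrite exprS; field.
by rewrite /theta subr_gt0 ltz_nat; case: ifP => _; field; rewrite ?q_neq0.
Qed.

Lemma sigma_WW i j : sigma (b (inr i, inr j)) =
  (q ^+ (i == j).+1) *: b (inr j, inr i)
  + (if (j < i)%N then q ^+ 2 - 1 else 0) *: b (inr i, inr j).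
Proof.
rewrite lfunE /= linext_bvec /= !tens_bvec lfunE /= linext_bvec !tens_bvec.
rewrite linearD !linearZ /= !incl_bvec scalerDr !scalerA.
congr (_ *: _ + _ *: _).
  by rewrite exprS; field.
by rewrite /theta subr_gt0 ltz_nat; case: ifP => _; field; rewrite ?q_neq0.
Qed.

(** Stated for an arbitrary [u] because it is applied to values of [R_WV^-1], which need not be
    basis vectors. *)
Lemma sigma_WV (u : VV) : sigma (incl (@inW N) (@inV N) u) =
  (q / s) *: incl (@inV N) (@inW N) (R_WV u).
Proof.
pose f : {linear VV -> HH K N} := sigma \o incl (@inW N) (@inV N).
pose g : {linear VV -> HH K N} :=
  (q / s) \*: (incl (@inV N) (@inW N) \o R_WV).
apply: (@eq_on_bvec _ _ _ f g) => -[i j] /=.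
by rewrite incl_bvec [LHS]lfunE /= linext_bvec /= tens_bvec.
Qed.

Lemma sigma_VW i j : sigma (b (inl i, inr j)) =
  incl (@inW N) (@inV N) ((s / q) *: (R_WV^-1)%VF (bvec K (i, j))).
Proof. by rewrite lfunE /= linext_bvec /= tens_bvec linearZ /= mulrC. Qed.

(** The argument on the right is sigma z for z = v_i (x) w_j. The scalars s / q and q / s are
    inverse to each other, so sigma (sigma z) = z and the two summands of z + sigma z are merely
    exchanged. *)
Lemma id_sigma_VW i j : id_sigma (b (inl i, inr j)) =
  id_sigma (incl (@inW N) (@inV N) ((s / q) *: (R_WV^-1)%VF (bvec K (i, j)))).
Proof.
rewrite [RHS]id_sigmaE sigma_WV !linearZ /= R_WV_invK incl_bvec scalerA.
rewrite id_sigmaE sigma_VW linearZ /= addrC; congr (_ + _).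
have -> : s / q * (q / s) = 1 by field; rewrite s_neq0 q_neq0.
by rewrite scale1r.
Qed.

(** Both sides equal q v_j (x) v_i + q^2 v_i (x) v_j. *)
Lemma id_sigma_VV_lt (i j : 'I_N) : (i < j)%N ->
  id_sigma (b (inl i, inl j)) = q *: id_sigma (b (inl j, inl i)).
Proof.
move=> ij; rewrite !id_sigmaE !sigma_VV ij ltnNge (ltnW ij) /=.
have ne : (i == j) = false by apply/eqP=> eij; rewrite eij ltnn in ij.
rewrite (eq_sym j) ne !expr1 scale0r addr0 scalerDr scalerA scalerBl scale1r.
by rewrite addrCA [X in _ + X]addrC subrK expr2.
Qed.

Lemma id_sigma_WW_gt (i j : 'I_N) : (j < i)%N ->
  id_sigma (b (inr i, inr j)) = q *: id_sigma (b (inr j, inr i)).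
Proof.
move=> ij; rewrite !id_sigmaE !sigma_WW ij ltnNge (ltnW ij) /=.
have ne : (i == j) = false by apply/eqP=> eij; rewrite eij ltnn in ij.
rewrite (eq_sym j) ne !expr1 scale0r addr0 scalerDr scalerA scalerBl scale1r.
by rewrite addrCA [X in _ + X]addrC subrK expr2.
Qed.

(** * Linear independence of the vectors V_ij, W_ij and M_ij *)

Lemma mem_index p : (p \in index) = match p with
  | (inl i, inl j) => (j <= i)%N
  | (inr i, inr j) => (i <= j)%N
  | (inr _, inl _) => true
  | (inl _, inr _) => false
  end.
Proof. by rewrite mem_filter mem_enum andbT. Qed.

Lemma incl_VW_index (u : VV) p :
  p \in index -> incl (@inV N) (@inW N) u p = 0.
Proof.
rewrite mem_index => p_in; rewrite /incl /linext sum_ffunE big1 // => -[k l] _.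
by case: p p_in => [[i|i] [j|j]] // _; rewrite !ffunE;
  case: eqP => [[]|_]; rewrite /inV /inW ?scaler0.
Qed.

(** Within [index], [sigma] contributes only when p = (a, a), where it adds q^2: otherwise it sends
    [b p] to a multiple of the swapped vector, outside [index], or into V (x) V^*, which [index]
    avoids. *)
Lemma id_sigma_coef p p' : p \in index -> p' \in index ->
  id_sigma (b p) p' =
  (p == p')%:R * (if p is (inr _, inl _) then 1 else
                  if p.1 == p.2 then 1 + q ^+ 2 else 1).
Proof.
rewrite id_sigmaE ffunE; case: p => [[i|i] [j|j]]; rewrite mem_index // => p_in.
- rewrite sigma_VV ltnNge p_in /= scale0r addr0 !ffunE.
  have [<-|ij] := eqVneq i j.
    by move=> _; rewrite eqxx /GRing.scale /=; ring.
  move=> p'_in; have -> : ((inl j, inl i) == p') = false.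
    apply/eqP=> jip'; case/eqP: ij; apply/val_inj/eqP.
    by move: p'_in; rewrite -jip' mem_index eqn_leq p_in => ->.
  by rewrite mulr0n scaler0 addr0 -[inl i == inl j]/(i == j) (negPf ij) mulr1.
- move=> p'_in; rewrite -[b _]/(b (inW i, inV j)) -incl_bvec sigma_WV incl_bvec.
  by rewrite !ffunE incl_VW_index // scaler0 addr0 mulr1.
- rewrite sigma_WW ltnNge p_in /= scale0r addr0 !ffunE.
  have [<-|ij] := eqVneq i j.
    by move=> _; rewrite eqxx /GRing.scale /=; ring.
  move=> p'_in; have -> : ((inr j, inr i) == p') = false.
    apply/eqP=> jip'; case/eqP: ij; apply/val_inj/eqP.
    by move: p'_in; rewrite -jip' mem_index eqn_leq p_in => ->.
  by rewrite mulr0n scaler0 addr0 -[inr i == inr j]/(i == j) (negPf ij) mulr1.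
Qed.

(** The diagonal entries are 1 or 1 + q^2, nonzero by [q2_neqN1]. *)
Lemma R_H_basis_free : free basis.
Proof.
apply: free_diagonal => [|p p_in|p p' p_in p'_in pp'].
- exact/filter_uniq/enum_uniq.
- rewrite id_sigma_coef // eqxx mul1r.
  by case: p {p_in} => [[i|i] [j|j]]; rewrite ?oner_neq0 //=; case: ifP;
    rewrite ?oner_neq0.
- by rewrite id_sigma_coef // (negPf pp') mul0r.
Qed.

(** * The form [beta], extended to H (x) H so as to compose with [id_sigma] *)

Definition beta_ext (z : HH K N) : K^o :=
  \sum_(k < size basis)
    coord (in_tuple basis) k z * [seq beta_val c p | p <- index]`_k.

Lemma beta_extE (x : subvs_of (R_H N q s)) : beta c x = beta_ext (vsval x).
Proof. by []. Qed.

Lemma beta_ext_linear : linear beta_ext.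
Proof.
move=> k x y; rewrite /beta_ext scaler_sumr -big_split; apply: eq_bigr => i _.
by rewrite linearP mulrDl [in RHS]/GRing.scale /= mulrA.
Qed.

HB.instance Definition _ :=
  GRing.isLinear.Build K (HH K N) K^o _ beta_ext beta_ext_linear.

(** By freeness [coord] is dual to [basis], so the sum collapses to the position of [p] in
    [index]. *)
Lemma beta_ext_basis p : p \in index ->
  beta_ext (id_sigma (b p)) = beta_val c p.
Proof.
move=> p_in; have lt_p : (seq.index p index < size basis)%N.
  by rewrite size_map index_mem.
have nth_p : id_sigma (b p) = (in_tuple basis)`_(Ordinal lt_p).
  by rewrite /= (nth_map p) ?index_mem // nth_index.
rewrite /beta_ext (bigD1 (Ordinal lt_p)) //= big1 ?addr0 => [|k kp].
  rewrite nth_p coord_free ?R_H_basis_free // eqxx mul1r.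
  by rewrite (nth_map p) ?index_mem // nth_index.
by rewrite nth_p coord_free ?R_H_basis_free // eq_sym (negPf kp) mul0r.
Qed.

HB.instance Definition _ := GRing.Linear.on (@pairing K N).
HB.instance Definition _ := GRing.Linear.on (@clifford_form K N q s c).

Lemma beta_ext_WV (u : VV) :
  beta_ext (id_sigma (incl (@inW N) (@inV N) u)) = c * pairing u.
Proof.
pose f : {linear VV -> K^o} :=
  beta_ext \o (id_sigma \o incl (@inW N) (@inV N)).
pose g : {linear VV -> K^o} := c \*: @pairing K N.
apply: (@eq_on_bvec _ _ _ f g) => -[i j] /=.
rewrite incl_bvec beta_ext_basis ?mem_index // /pairing linext_bvec.
by rewrite /GRing.scale /= mulrC.
Qed.

Lemma beta_ext_id_sigma z :
  beta_ext (id_sigma z) = clifford_form q s c z.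
Proof.
pose f : {linear HH K N -> K^o} := beta_ext \o id_sigma.
apply: (@eq_on_bvec _ _ _ f (clifford_form q s c)) => -[[i|i] [j|j]] /=.
- rewrite /clifford_form linext_bvec; have [ji|ij] := leqP j i.
    by rewrite beta_ext_basis ?mem_index.
  (* Here V_ij is a multiple of V_ji, on which the form vanishes. *)
  rewrite id_sigma_VV_lt // linearZ /= beta_ext_basis ?mem_index ?(ltnW ij) //.
  exact: scaler0.
(* Moving to V^* (x) V through [id_sigma_VW] produces the very expression that defines the form on
   this block. *)
- by rewrite /clifford_form linext_bvec tens_bvec id_sigma_VW beta_ext_WV
    (mulrC s).
- by rewrite beta_ext_basis ?mem_index // /clifford_form linext_bvec
    tens_bvec /pairing linext_bvec mulrC.
- rewrite /clifford_form linext_bvec; have [ij|ji] := leqP i j.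
    by rewrite beta_ext_basis ?mem_index.
  rewrite id_sigma_WW_gt // linearZ /= beta_ext_basis ?mem_index ?(ltnW ji) //.
  exact: scaler0.
Qed.

(** * Comparison of the two sets of relations *)

HB.instance Definition _ := GRing.Linear.on (@iota2 K N).

(** Common shape of both sets: all z give [Cl_rel], and the pure tensors z give [clifford_rel]. *)
Definition relator (z : HH K N) : TH K N :=
  iota2 (id_sigma z) - (clifford_form q s c z : K)%:A.

Lemma relator_linear : linear relator.
Proof.
move=> k x y; rewrite /relator !linearP scalerBr scalerA.
by rewrite scalerDl -scalerA opprD addrACA.
Qed.

HB.instance Definition _ :=
  GRing.isLinear.Build K (HH K N) (TH K N) _ relator relator_linear.

Lemma relator_Cl z : Cl_rel N q s c (relator z).
Proof.
have z_in : id_sigma z \in R_H N q s by exact: memv_img (memvf _).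
exists (Subvs z_in); first by [].
have zE : vsval (Subvs z_in) = id_sigma z by [].
by rewrite beta_extE zE beta_ext_id_sigma.
Qed.

Lemma relator_clifford x y : clifford_rel N q s c (relator (tens x y)).
Proof.
exists x; first by []; exists y; first by [].
by rewrite -id_sigmaE.
Qed.

(** Lift an element of R_H to some z and expand z in basis vectors, which are pure tensors;
    linearity of [relator] does the rest. *)
Lemma Cl_sub_clifford :
  (Cl_rel N q s c `<=` ideal_gen (clifford_rel N q s c))%classic.
Proof.
have [I0 ID _ _] := ideal_genP (clifford_rel N q s c).
move=> _ [x _ <-]; have /memv_imgP[z _ xE] := valP x.
have -> : iota2 (vsval x) - (beta c x)%:A = relator z.
  by rewrite beta_extE xE beta_ext_id_sigma.
rewrite (bsp_sum z) linear_sum; elim/big_ind: _ => // -[i j] _.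
rewrite linearZ -tens_bvec; apply: ideal_genZ => I [_]; apply.
exact: relator_clifford.
Qed.

Lemma clifford_sub_Cl :
  (clifford_rel N q s c `<=` ideal_gen (Cl_rel N q s c))%classic.
Proof.
move=> _ [x _ [y _ <-]] I [_]; apply.
by rewrite -id_sigmaE; exact: relator_Cl.
Qed.

End Clifford.

Theorem proposition8p1 (R : realType) (N : nat) (q s c : R[i])
    (hN : (2 <= N)%N)
    (hq0 : q != 0)
    (hq : forall n : nat, (0 < n)%N -> ~~ n.-unity_root q)
    (hs : s ^+ N = q)
    (hc : c != 0) :
  exists f : {linear quot_alg (Cl_rel N q s c) ->
                     quot_alg (clifford_rel N q s c)},
    monoid_morphism f /\ bijective f.
Proof.
have s_neq0 : s != 0.
  by apply: contra_neq hq0 => s0; rewrite -hs s0 expr0n; case: N hN {hs}.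
have q2_neqN1 : 1 + q ^+ 2 != 0.
  (* If q^2 = -1, then q^4 = 1 and q is a root of unity. *)
  apply: contraNneq (hq 4 isT) => q2; apply/unity_rootP.
  have -> : q ^+ 4 = (q ^+ 2) ^+ 2 by rewrite -exprM.
  have -> : q ^+ 2 = -1 by apply/eqP; rewrite -addr_eq0 addrC q2.
  by rewrite sqrrN expr1n.
apply: quot_iso; apply: ideal_gen_sub.
- exact: Cl_sub_clifford.
- exact: clifford_sub_Cl.
Qed.
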